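(* Let $\rho_{\mathbf x},\rho_{\mathbf y},\rho_{\mathbf z}$ be stationary ergodic processes with alphabet $A$ such that $\rho_{\mathbf x}\neq\rho_{\mathbf y}$ and either $\rho_{\mathbf z}=\rho_{\mathbf x}$ or $\rho_{\mathbf z}=\rho_{\mathbf y}$. Let $\mathbf x,\mathbf y,\mathbf z$ be initial segments, of lengths $|\mathbf x|,|\mathbf y|,|\mathbf z|$, of sequences distributed according to $\rho_{\mathbf x},\rho_{\mathbf y},\rho_{\mathbf z}$ respectively. Define $L(\mathbf x,\mathbf y,\mathbf z):=\text{``x''}$ if $\hat d(\mathbf x,\mathbf z)\le\hat d(\mathbf y,\mathbf z)$, and $L(\mathbf x,\mathbf y,\mathbf z):=\text{``y''}$ otherwise. Then, with probability 1, the test $L$ makes only a finite number of errors as $|\mathbf x|,|\mathbf y|,|\mathbf z|\to\infty$: if $\rho_{\mathbf x}=\rho_{\mathbf z}$, then with probability 1 there is a (random) $N$ such that $L(\mathbf x,\mathbf y,\mathbf z)=\text{``x''}$ whenever $|\mathbf x|,|\mathbf y|,|\mathbf z|\ge N$; otherwise, with probability 1 there is a (random) $N$ such that $L(\mathbf x,\mathbf y,\mathbf z)=\text{``y''}$ whenever $|\mathbf x|,|\mathbf y|,|\mathbf z|\ge N$.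
   Context: The alphabet $A$ is $\mathbb R$ or a finite set. A process is a probability measure on $A^\infty$ with its Borel sigma-algebra. For $\mathbf x=X_{1..n}\in A^n$ and measurable $B\subset A^k$, the frequency is $\nu(\mathbf x,B):=\frac1{n-k+1}\sum_{i=1}^{n-k+1}\mathbf 1\{(X_i,\dots,X_{i+k-1})\in B\}$ if $n\ge k$, and $0$ otherwise. A process $\rho$ is stationary if $\rho(X_{1..j}\in B)=\rho(X_{i..i+j-1}\in B)$ for all $i,j\ge1$ and measurable $B\subset A^j$; it is ergodic if for every $k$ and measurable $B\subset A^k$ the frequency $\nu(X_{1..n},B)$ converges $\rho$-almost surely to a constant as $n\to\infty$; it is stationary ergodic if it is both. Let $w_k:=1/(k(k+1))$. The empirical distributional distance between samples $\mathbf x,\mathbf y$ is: for finite $A$, $\hat d(\mathbf x,\mathbf y):=\sum_{k=1}^\infty w_k\sum_{B\in A^k}|\nu(\mathbf x,B)-\nu(\mathbf y,B)|$ (a word $B\in A^k$ being identified with the singleton $\{B\}\subset A^k$); for $A=\mathbb R$, $\hat d(\mathbf x,\mathbf y):=\sum_{m,l=1}^\infty w_mw_l\sum_{B\in B^{m,l}}|\nu(\mathbf x,B)-\nu(\mathbf y,B)|$, where $B^{m,l}$ is the partition of $\mathbb R^m$ into cubes of dimension $m$ and volume $2^{-ml}$ (side $2^{-l}$), starting at the origin. *)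

(* Defs.v *)
From HB Require Import structures.
From mathcomp Require Import all_boot all_order all_algebra.
From mathcomp Require Import all_classical all_reals all_analysis.
Set Implicit Arguments.
Unset Strict Implicit.
Unset Printing Implicit Defensive.
Import Order.TTheory GRing.Theory Num.Theory.
Import numFieldNormedType.Exports.
Local Open Scope classical_set_scope.
Local Open Scope ring_scope.

Definition borel (T : topologicalType) := g_sigma_algebraType (@open T).

(* A finite alphabet carries the discrete topology. An alphabet has to be
   pointed because the library requires measurable spaces to be so; no process
   has an empty alphabet. *)
Inductive alphabet (R : realType) : Type :=
| real_alphabet
| finite_alphabet (A : pdiscreteTopologicalType) of finite_set [set: A].

Definition letter (R : realType) (a : alphabet R) : ptopologicalType :=
  match a with
  | real_alphabet => R
  | finite_alphabet A _ => A
  end.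

Section processes.
Context (A : ptopologicalType) (R : realType).

(* Products carry the product topology, and positions are counted from 0. *)
Definition word (k : nat) := borel {ptws 'I_k -> A}.
Definition infinite_word := borel {ptws nat -> A}.

Definition process := probability infinite_word R.

(* Measures of the library are functions on all subsets, with arbitrary values
   on non-measurable ones, so the equality of two processes as measures is
   equality on measurable sets, and not Leibniz equality. *)
Definition same_law (mu nu : set infinite_word -> \bar R) :=
  forall B : set infinite_word, measurable B -> mu B = nu B.

(* Meaningful only when i + k <= size x; `point` is then never used. *)
Definition window (k : nat) (x : seq A) (i : nat) : word k :=
  fun j : 'I_k => nth point x (i + j).

Definition freq (k : nat) (x : seq A) (B : set (word k)) : R :=
  if (k <= size x)%N then
    (size x - k + 1)%:R^-1 *
      \sum_(0 <= i < size x - k + 1) \1_B (window x i)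
  else 0.

Definition block (k i : nat) (s : infinite_word) : word k :=
  fun j : 'I_k => s (i + j)%N.

Definition stationary (rho : process) :=
  forall (i k : nat) (B : set (word k)), (0 < k)%N -> measurable B ->
    rho (block 0 @^-1` B) = rho (block i @^-1` B).

Definition ergodic (rho : process) :=
  forall (k : nat) (B : set (word k)), (0 < k)%N -> measurable B ->
    exists c : R,
      {ae rho, forall s, freq (mkseq s n) B @[n --> \oo] --> c}.

Definition stationary_ergodic (rho : process) := stationary rho /\ ergodic rho.

End processes.

Section distributional_distance.
Context (R : realType).
Local Open Scope ereal_scope.

Definition weight (k : nat) : R := ((k * k.+1)%:R^-1)%R.

Definition dhat_finite (A : ptopologicalType) (x y : seq A) : \bar R :=
  \sum_(1 <= k <oo) (weight k)%:E *
    \esum_(b in [set: word A k])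
      `|freq R x [set b] - freq R y [set b]|%:E.

Definition cube (m l : nat) (c : 'I_m -> int) : set (word R m) :=
  [set t | forall j : 'I_m,
    ((c j)%:~R * 2 ^- l <= t j < (c j + 1)%:~R * 2 ^- l)%R].

Definition cubes (m l : nat) : set (set (word R m)) := range (@cube m l).

Definition dhat_real (x y : seq R) : \bar R :=
  \sum_(1 <= m <oo) \sum_(1 <= l <oo) (weight m * weight l)%:E *
    \esum_(B in @cubes m l) `|freq R x B - freq R y B|%:E.

Definition dhat (a : alphabet R) : seq (letter a) -> seq (letter a) -> \bar R :=
  match a return seq (letter a) -> seq (letter a) -> \bar R with
  | real_alphabet => dhat_real
  | finite_alphabet A _ => @dhat_finite A
  end.

Inductive label := label_x | label_y.

Definition L (a : alphabet R) (x y z : seq (letter a)) : label :=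
  if @dhat a x z <= @dhat a y z then label_x else label_y.

End distributional_distance.

(* Main.v *)
Require Import Defs.
From HB Require Import structures.
From mathcomp Require Import all_boot all_order all_algebra.
From mathcomp Require Import all_classical all_reals all_analysis.
From mathcomp Require Import measurable_realfun finmap ring lra.
Set Implicit Arguments.
Unset Strict Implicit.
Unset Printing Implicit Defensive.
Import Order.TTheory GRing.Theory Num.Theory.
Import numFieldNormedType.Exports.
Local Open Scope classical_set_scope.
Local Open Scope ring_scope.

(** By ergodicity and stationarity the frequency of a measurable set of words
    along a sample converges almost surely to the probability of the
    corresponding cylinder ([freq_cvg]). The cells of all partitions in the
    distance are countably many, so almost every sample path has the right limit
    on all of them simultaneously; call such a path typical. From here on the
    argument is deterministic.

    Two typical paths of the same law have empirical distance tending to 0: on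
    each partition the empirical frequencies converge cell by cell to a
    probability vector, hence in total variation by Scheffe's argument
    ([scheffe]), and the summable weights give uniform control of the tail of
    the series ([weighted_series_small]).

    If the laws differ, then they differ on the cylinder over some cell: the
    cells of dimension and resolution [n], for increasing [n], form nested
    partitions that generate the product topology, and such partitions determine
    a probability measure ([nested_partitions_determine], [same_law_cells]). The
    term of that one cell keeps the distance of typical paths away from 0
    ([cell_distance_bounded_below]).

    Hence the sample with the law of [z] eventually is strictly closer to [z]
    than the other one ([same_law_eventually_closer]). Both alphabets are
    treated at once through the notion of a resolving family of partitions; the
    singletons of words over a finite alphabet and the dyadic cubes form such
    families. *)

(** * Weighted series and total variation *)

Section weights.
Context (R : realType).

Lemma weight_ge0 k : 0 <= weight R k.
Proof. by rewrite invr_ge0. Qed.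

(** The weights telescope: [1/(k(k+1)) = 1/k - 1/(k+1)]. *)
Lemma sum_weight a b : (0 < a)%N -> (a <= b)%N ->
  \sum_(a <= k < b) weight R k = a%:R^-1 - b%:R^-1.
Proof.
move=> a0 ab; rewrite -[RHS]opprB -(@telescope_sumr _ a b (fun k => k%:R^-1))//.
rewrite -sumrN; apply: eq_big_nat => k /andP[ak _].
have k0 : k%:R != 0 :> R by rewrite pnatr_eq0 -lt0n (leq_trans a0).
have k1 : k.+1%:R != 0 :> R by rewrite pnatr_eq0.
rewrite opprB /weight natrM invfM.
have -> : k.+1%:R = k%:R + 1 :> R by rewrite -natr1.
rewrite -natr1 in k1.
by field; rewrite k0 k1.
Qed.

Lemma weighted_series_le (E : nat -> \bar R) (M : R) :
  (forall k, 0 <= E k)%E -> (forall k, E k <= M%:E)%E -> 0 <= M ->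
  (\sum_(1 <= k <oo) (weight R k)%:E * E k <= M%:E)%E.
Proof.
move=> E0 EM M0; apply: lime_le.
  by apply: is_cvg_nneseries => k _ _; rewrite mule_ge0// lee_fin weight_ge0.
near=> n; have n1 : (1 <= n)%N by near: n; exists 1%N.
rewrite (@le_trans _ _ (\sum_(1 <= k < n) (weight R k * M)%:E)%E)//.
  by apply: lee_sum => k _; rewrite EFinM lee_wpmul2l ?lee_fin ?weight_ge0.
rewrite sumEFin lee_fin -big_distrl/= sum_weight//.
by rewrite ler_piMl// invr1 gerBl invr_ge0.
Unshelve. all: by end_near. Qed.

(** The full sequence of weights adds up to 1, so an index on which a summand
    does not depend can be summed away. *)
Lemma weighted_series_cst (M : R) :
  (\sum_(1 <= k <oo) (weight R k)%:E * M%:E = M%:E)%E.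
Proof.
under eq_eseriesr do rewrite muleC.
rewrite nneseriesZl; last by move=> k _; rewrite lee_fin weight_ge0.
rewrite -[RHS]mule1; congr (_ * _)%E; apply/cvg_lim => //.
under eq_fun do rewrite sumEFin.
apply: cvg_EFin; first exact: nearW.
rewrite -cvg_shiftS/=.
have : 1 - harmonic n @[n --> \oo] --> (1 - 0 : R).
  by apply: cvgB; [exact: cvg_cst|exact: cvg_harmonic].
rewrite subr0; apply: cvg_trans; apply: near_eq_cvg; apply: nearW => n /=.
by rewrite sum_weight// invr1.
Qed.

(** Dominated convergence for weighted series: the tail is small uniformly in
    the parameter because the summands are bounded, and what is left is a finite
    sum of small terms. *)
Lemma weighted_series_small (T : Type) (F : set_system T) {FF : Filter F}
    (E : T -> nat -> \bar R) (M : R) :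
  (forall t k, 0 <= E t k)%E -> (forall t k, E t k <= M%:E)%E ->
  (forall k (e : R), (0 < k)%N -> 0 < e ->
    \forall t \near F, (E t k <= e%:E)%E) ->
  forall e : R, 0 < e ->
    \forall t \near F,
      (\sum_(1 <= k <oo) (weight R k)%:E * E t k <= e%:E)%E.
Proof.
move=> E0 EM Esmall e e0.
(* the weights from K on add up to 1 / K, so the tail is at most M / K *)
pose K := (Num.truncn (`|M| / (e / 2))).+1.
have KM : `|M| / K%:R <= e / 2.
  rewrite ler_pdivrMr// mulrC -ler_pdivrMr; last by rewrite divr_gt0.
  by rewrite ltW// truncnS_gt.
have head : \forall t \near F, forall k : 'I_K,
    (0 < k)%N -> (E t k <= (e / 2)%:E)%E.
  apply: filter_forall => k; have [->|k0] := posnP k; first by apply: nearW.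
  by near=> t => _; near: t; apply: Esmall => //; rewrite divr_gt0.
apply: filterS head => t head; apply: lime_le.
  by apply: is_cvg_nneseries => k _ _; rewrite mule_ge0// lee_fin weight_ge0.
near=> n; have Kn : (K <= n)%N by near: n; exists K.
rewrite (big_cat_nat _ Kn)//= [e in leRHS]splitr EFinD leeD//.
  apply: (@le_trans _ _ (\sum_(1 <= k < K) (weight R k * (e / 2))%:E)%E).
    rewrite !big_nat; apply: lee_sum => k /andP[k1 kK].
    rewrite EFinM lee_wpmul2l ?lee_fin ?weight_ge0//.
    exact: (head (Ordinal kK)).
  rewrite sumEFin lee_fin -big_distrl/= sum_weight//.
  by rewrite ler_piMl ?invr1 ?gerBl ?invr_ge0// ltW// divr_gt0.
apply: (@le_trans _ _ (\sum_(K <= k < n) (weight R k * `|M|)%:E)%E).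
  apply: lee_sum => k _; rewrite EFinM lee_wpmul2l ?lee_fin ?weight_ge0//.
  by rewrite (le_trans (EM _ _))// lee_fin ler_norm.
rewrite sumEFin lee_fin -big_distrl/= sum_weight// (le_trans _ KM)//.
by rewrite mulrC ler_wpM2l// gerBl invr_ge0.
Unshelve. all: by end_near. Qed.

End weights.

(** Two families of subprobability weights that converge pointwise to the same
    probability weights get close in total variation: no mass escapes, because a
    finite set that carries almost all of [p] eventually carries almost all of
    the common part [min(u, v)]. Only pointwise convergence is asked for, which
    is what makes partitions with infinitely many cells tractable. *)
Lemma scheffe (R : realType) (I : choiceType) (S : set I) (T : Type)
    (F : set_system T) {FF : Filter F} (u v : T -> I -> R) (p : I -> R) :
  (forall t i, S i -> 0 <= u t i) -> (forall t i, S i -> 0 <= v t i) ->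
  (forall t, \esum_(i in S) (u t i)%:E <= 1)%E ->
  (forall t, \esum_(i in S) (v t i)%:E <= 1)%E ->
  (1 <= \esum_(i in S) (p i)%:E)%E ->
  (forall i, S i -> u t i @[t --> F] --> p i) ->
  (forall i, S i -> v t i @[t --> F] --> p i) ->
  forall e : R, 0 < e ->
    \forall t \near F, (\esum_(i in S) `|u t i - v t i|%:E <= e%:E)%E.
Proof.
move=> u0 v0 u1 v1 p1 up vp e e0.
have : ((1 - e / 2)%:E < \esum_(i in S) (p i)%:E)%E.
  by apply: lt_le_trans p1; rewrite lte_fin; lra.
move=> /ereal_sup_gt[_ [X [finX XS] <-]].
rewrite fsbig_finite//= sumEFin lte_fin => pX.
have : \sum_(i <- fset_set X) Num.min (u t i) (v t i) @[t --> F] -->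
    \sum_(i <- fset_set X) p i.
  rewrite big_seq; under eq_fun do rewrite big_seq.
  apply: cvg_big => [|i]; first exact: add_continuous.
  rewrite in_fset_set// => /set_mem/XS Si.
  have -> : p i = (p i + p i - `|p i - p i|) / 2 by rewrite subrr normr0; lra.
  under eq_fun do rewrite minr_absE.
  apply: cvgMr_tmp; apply: cvgB; first by apply: cvgD; [exact: up|exact: vp].
  by apply: cvg_norm; apply: cvgB; [exact: up|exact: vp].
move=> /(cvgr_gt (\sum_(i <- fset_set X) p i)) /(_ _ pX).
apply: filterS => t mint.
have min0 i : S i -> (0 <= (2 * Num.min (u t i) (v t i))%:E)%E.
  by move=> Si; rewrite lee_fin mulr_ge0// le_min u0 ?v0.
(* |u - v| + 2 min(u, v) = u + v *)
have : (\esum_(i in S) `|u t i - v t i|%:E +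
        \esum_(i in S) (2 * Num.min (u t i) (v t i))%:E <= 2%:E)%E.
  rewrite -esumD//.
  rewrite (_ : esum _ _ =
    \esum_(i in S) ((u t i)%:E + (v t i)%:E)%E); last first.
    apply: eq_esum => i Si; rewrite -!EFinD; congr EFin.
    rewrite /Num.min; case: ltP => uv.
      by rewrite ltr0_norm ?subr_lt0//; lra.
    by rewrite ger0_norm ?subr_ge0//; lra.
  rewrite esumD//; last 2 first.
  - by move=> i Si; rewrite lee_fin u0.
  - by move=> i Si; rewrite lee_fin v0.
  by rewrite (_ : 2 = 1 + 1 :> R)// EFinD leeD.
have : ((2 - e)%:E <= \esum_(i in S) (2 * Num.min (u t i) (v t i))%:E)%E.
  apply: esum_ge; exists X => //; rewrite fsbig_finite//= sumEFin lee_fin.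
  by rewrite -big_distrr/=; lra.
move=> lo hi.
have := le_trans (leeD2l (\esum_(i in S) `|u t i - v t i|%:E) lo) hi.
rewrite -leeBrDr// -EFinB; move/le_trans; apply; rewrite lee_fin; lra.
Qed.

(** * Countable partitions of measurable spaces *)

Section countable_partitions.
Context d (U : measurableType d) (R : realType).

Definition countable_partition (S : set (set U)) :=
  [/\ countable S, S `<=` measurable, trivIset S id &
     \bigcup_(B in S) B = setT].

Lemma countable_enum (I : Type) (S : set I) : countable S -> S !=set0 ->
  exists (D : set nat) (g : nat -> I), set_bij D S g.
Proof.
move=> /countable_injP[f finj] [i0 Si0]; pose g := 'pinv_(fun=> i0) S f.
have gK i : S i -> g (f i) = i.
  by move=> Si; exact: (pinvKV (fun=> i0) finj (mem_set Si)).
exists (f @` S), g; split => [_ [i Si <-]|m n|i Si] /=.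
- by rewrite gK.
- by move=> /set_mem[i Si <-] /set_mem[j Sj <-]; rewrite !gK// => ->.
- by exists (f i); [exists i|exact: gK].
Qed.

Lemma bigcup_measurable_countable (I : Type) (S : set I) (B : I -> set U) :
  countable S -> (forall i, S i -> measurable (B i)) ->
  measurable (\bigcup_(i in S) B i).
Proof.
move=> cS mB.
have [->|/set0P/(countable_enum cS)[D [g [gS _ gsurj]]]] := eqVneq S set0.
  by rewrite bigcup_set0.
rewrite (reindex_bigcup g D)//; apply: bigcup_measurable => n Dn.
exact/mB/gS.
Qed.

Lemma measure_bigcup_countable (I : choiceType) (S : set I) (B : I -> set U)
    (mu : {measure set U -> \bar R}) :
  countable S -> (forall i, S i -> measurable (B i)) -> trivIset S B ->
  mu (\bigcup_(i in S) B i) = \esum_(i in S) mu (B i).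
Proof.
move=> cS mB tB.
have [->|/set0P/(countable_enum cS)[D [g gbij]]] := eqVneq S set0.
  by rewrite bigcup_set0 measure0 esum_set0.
have [gS ginj gsurj] := gbij.
rewrite (reindex_esum _ _ _ _ gbij) (reindex_bigcup g D)//.
rewrite measure_bigcup//=.
- by rewrite nneseries_esum ?set_mem_set.
- by move=> n /gS; exact: mB.
- move=> m n Dm Dn Bmn; apply: ginj; [exact: mem_set|exact: mem_set|].
  by apply: tB Bmn; exact: gS.
Qed.

(** Countable index sets are embedded into the naturals, where almost sure
    statements may be intersected. *)
Lemma ae_countable (I : Type) (S : set I) (mu : {measure set U -> \bar R})
    (P : I -> U -> Prop) :
  countable S -> (forall i, S i -> {ae mu, forall x, P i x}) ->
  {ae mu, forall x, forall i, S i -> P i x}.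
Proof.
move=> /countable_injP[f finj] aeP.
have : {ae mu, forall x, forall n, forall i, S i -> f i = n -> P i x}.
  apply: ae_foralln => n.
  have [[i [Si fi]]|nex] := pselect (exists i, S i /\ f i = n).
    apply: filterS (aeP i Si) => x Pix j Sj fj.
    suff -> : j = i by [].
    by apply: finj; [exact: mem_set|exact: mem_set|rewrite fi fj].
  by apply: nearW => x i Si fi; exfalso; apply: nex; exists i.
by apply: filterS => x + i Si => /(_ (f i) i Si erefl).
Qed.

End countable_partitions.

(** Each [U] in [G] is the increasing union over [n] of the union of the cells
    of [Q n] inside [U]. The measure of this inner approximation is a countable
    sum of measures of cells, on which [mu] and [nu] agree, so they agree on [G]
    by continuity from below, and on the generated sigma-algebra because [G] is
    a pi-system. *)
Lemma nested_partitions_determine (T : pointedType) (G : set (set T))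
    (R : realType) (Q : nat -> set (set (g_sigma_algebraType G)))
    (mu nu : probability (g_sigma_algebraType G) R) :
  setI_closed G -> G setT ->
  (forall n, countable_partition (Q n)) ->
  (forall n B B', Q n B -> Q n.+1 B' -> B `&` B' !=set0 -> B' `<=` B) ->
  (forall U s, G U -> U s ->
    exists n B, [/\ Q n B, B s & B `<=` U]) ->
  (forall n B, Q n B -> mu B = nu B) ->
  forall B : set (g_sigma_algebraType G), measurable B -> mu B = nu B.
Proof.
move=> GI GT partQ nestQ fineQ munu.
pose inner (U : set (g_sigma_algebraType G)) n :=
  \bigcup_(B in [set B | Q n B /\ B `<=` U]) B.
have innerE (m : probability (g_sigma_algebraType G) R) U n :
    m (inner U n) = \esum_(B in [set B | Q n B /\ B `<=` U]) m B.
  have [cQ mQ tQ _] := partQ n.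
  rewrite -measure_bigcup_countable//.
  - by apply: sub_countable cQ; apply: subset_card_le => B [].
  - by move=> B [/mQ].
  - by apply: sub_trivIset tQ => B [].
have minner U n : measurable (inner U n).
  have [cQ mQ tQ _] := partQ n.
  apply: bigcup_measurable_countable => [|B [/mQ]//].
  by apply: sub_countable cQ; apply: subset_card_le => B [].
have munu_open (U : set (g_sigma_algebraType G)) : G U -> mu U = nu U.
  move=> oU.
  have innerU : \bigcup_n inner U n = U.
    apply/seteqP; split => [s [n _ [B [_ BU] /BU]]//|s Us].
    have [n [B [QB Bs BU]]] := fineQ _ _ oU Us.
    by exists n => //; exists B.
  have inner_nd : nondecreasing_seq (inner U).
    apply/nondecreasing_seqP => n; apply/subsetPset => s [B [QB BU] Bs].
    have [_ _ _ /seteqP[_ /(_ s I)[B' QB' B's]]] := partQ n.+1.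
    exists B' => //; split => //; apply: subset_trans BU.
    by apply: nestQ QB QB' _; exists s.
  have cvg_inner (m : probability (g_sigma_algebraType G) R) :
      m (inner U n) @[n --> \oo] --> m U.
    rewrite -[in X in _ --> X]innerU; apply: nondecreasing_cvg_mu => //.
    by rewrite innerU; apply: sub_sigma_algebra.
  have /cvg_lim <- // := cvg_inner mu; have /cvg_lim <- // := cvg_inner nu.
  congr (lim (_ @ \oo)); apply/funext => n; rewrite !innerE.
  by apply: eq_esum => B [QB _]; exact: munu QB.
apply: (@measure_unique _ R (g_sigma_algebraType G) G (fun=> setT)) => //.
- by rewrite bigcup_const.
- by move=> _; rewrite (le_lt_trans (probability_le1 _ _))// ltry.
Qed.

(** * Words, cylinders and frequencies *)

Section words.
Context (A : ptopologicalType) (R : realType).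

Lemma cvg_ptws (I : Type) (T : Type) (F : set_system T) (f : T -> {ptws I -> A})
    (l : {ptws I -> A}) : Filter F ->
  (forall i, f t i @[t --> F] --> l i) -> f @ F --> l.
Proof.
move=> FF fl; apply/cvg_sup => i B [_ [[C oC <-] Cli] CB].
by apply: filterS CB _; apply: fl; exact: open_nbhs_nbhs.
Qed.

Lemma continuous_coordinate (I : eqType) (i : I) :
  continuous (fun f : {ptws I -> A} => f i).
Proof. exact: (@proj_continuous I (fun=> A) i). Qed.

Lemma measurable_coordinate k (j : 'I_k) (V : set A) :
  open V -> measurable [set t : word A k | V (t j)].
Proof.
move=> oV; apply: sub_sigma_algebra.
exact: (iffLR (continuousP _) (@continuous_coordinate 'I_k j) V oV).
Qed.

Lemma continuous_block k i :
  continuous (@block A k i : {ptws nat -> A} -> {ptws 'I_k -> A}).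
Proof.
by move=> s; apply: cvg_ptws => j; exact: (@continuous_coordinate nat).
Qed.

Lemma measurable_forall_coordinate k (P : 'I_k -> set (word A k)) :
  (forall j, measurable (P j)) -> measurable [set t | forall j, P j t].
Proof.
move=> mP; rewrite (_ : mkset _ = ~` \bigcup_(j in setT) ~` P j).
  apply/measurableC/bigcup_measurable_countable => // j _.
  exact: measurableC.
rewrite setC_bigcup; apply/seteqP; split => [t Pt j _|t Pt j]; rewrite ?setCK//.
by have := Pt j I; rewrite setCK.
Qed.

Lemma measurable_block k i :
  measurable_fun [set: infinite_word A] (@block A k i).
Proof.
apply: (@measurability _ _ _ _ setT (@block A k i)
  (@open {ptws 'I_k -> A})) => //.
move=> _ [V oV <-]; rewrite setTI; apply: sub_sigma_algebra.
exact: (iffLR (continuousP _) (@continuous_block k i) V oV).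
Qed.

Lemma measurable_cylinder k i (B : set (word A k)) :
  measurable B -> measurable (@block A k i @^-1` B).
Proof.
by move=> mB; rewrite -[X in measurable X]setTI; exact: measurable_block.
Qed.

Lemma window_mkseq k n i (s : infinite_word A) : (i + k <= n)%N ->
  @window A k (mkseq s n) i = block i s.
Proof.
move=> ikn; apply/funext => j; rewrite /window nth_mkseq//.
by rewrite (leq_trans _ ikn)// ltn_add2l.
Qed.

Lemma freq_mkseq k n (s : infinite_word A) (B : set (word A k)) : (k <= n)%N ->
  freq R (mkseq s n) B =
  (n - k + 1)%:R^-1 * \sum_(0 <= i < n - k + 1) \1_B (block i s).
Proof.
move=> kn; rewrite /freq size_mkseq kn; congr (_ * _).
apply: eq_big_nat => i /andP[_ ink]; rewrite window_mkseq//.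
by move: ink; rewrite addn1 ltnS leq_subRL// addnC.
Qed.

Lemma freq_ge0 k (x : seq A) (B : set (word A k)) : 0 <= freq R x B.
Proof. by rewrite /freq; case: ifP => // _; rewrite mulr_ge0// sumr_ge0. Qed.

(** Each window lies in at most one of the disjoint sets. Even for a
    partition the sum may differ from 1, since all frequencies of a sample
    shorter than [k] are 0. *)
Lemma sum_freq_le1 k (x : seq A) (S : set (set (word A k))) :
  trivIset S id -> (\esum_(B in S) (freq R x B)%:E <= 1)%E.
Proof.
move=> tS; apply: ge_ereal_sup => _ [X [finX XS] <-].
rewrite fsbig_finite//= sumEFin lee_fin /freq.
case: (k <= size x)%N; last by rewrite big1.
rewrite -big_distrr/= exchange_big/= ler_pdivrMl ?mulr1; last first.
  by rewrite ltr0n addn1.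
rewrite (@le_trans _ _ (\sum_(0 <= i < size x - k + 1) 1))//; last first.
  by rewrite sumr_const_nat subn0.
apply: ler_sum => i _.
have [[B XB Bw]|noB] := pselect (exists2 B, X B & B (window x i)).
  rewrite (bigD1_seq B)/= ?fset_uniq//; last first.
    by rewrite in_fset_set//; exact: mem_set.
  rewrite indicE mem_set// big_seq_cond big1 ?addr0// => C.
  rewrite in_fset_set// => /andP[/set_mem XC CB].
  rewrite indicE memNset// => Cw; move/eqP: CB; apply.
  by apply: tS; [exact: XS|exact: XS|exists (window x i)].
rewrite big_seq big1// => B; rewrite in_fset_set// => /set_mem XB.
by rewrite indicE memNset// => Bw; apply: noB; exists B.
Qed.

Lemma freq_le1 k (x : seq A) (B : set (word A k)) : freq R x B <= 1.
Proof.
rewrite -lee_fin -(@esum_set1 _ _ B (fun C => (freq R x C)%:E)); last first.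
  by rewrite lee_fin freq_ge0.
by apply: sum_freq_le1 => C D -> ->.
Qed.

Lemma sum_freq_dist_le2 k (x y : seq A) (S : set (set (word A k))) :
  trivIset S id ->
  (\esum_(B in S) `|freq R x B - freq R y B|%:E <= 2%:E)%E.
Proof.
move=> tS; rewrite (_ : 2 = 1 + 1 :> R)// EFinD.
apply: le_trans (leeD (sum_freq_le1 x tS) (sum_freq_le1 y tS)).
rewrite -esumD; [|by move=> B _; rewrite lee_fin freq_ge0..].
apply: le_esum => B _; rewrite -EFinD lee_fin (le_trans (ler_normB _ _))//.
by rewrite !ger0_norm ?freq_ge0.
Qed.

Lemma measurable_freq k n (B : set (word A k)) : measurable B ->
  measurable_fun setT (fun s : infinite_word A => freq R (mkseq s n) B).
Proof.
move=> mB; have [kn|nk] := leqP k n; last first.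
  rewrite /freq (_ : (fun s => _) = cst 0); first exact: measurable_cst.
  by apply/funext => s; rewrite size_mkseq leqNgt nk.
rewrite (_ : (fun s => _) = (fun s => (n - k + 1)%:R^-1 *
    \sum_(0 <= i < n - k + 1) \1_B (block i s))); last first.
  by apply/funext => s; rewrite freq_mkseq.
apply: measurable_funM => //; apply: measurable_sum => i.
exact: measurableT_comp (measurable_indic mB) (measurable_block i).
Qed.

End words.

(** * The ergodic limit of frequencies *)

Section ergodic_frequencies.
Context (A : ptopologicalType) (R : realType) (rho : process A R).

Lemma expected_freq k n (B : set (word A k)) :
  stationary rho -> (0 < k)%N -> (k <= n)%N -> measurable B ->
  (\int[rho]_s (freq R (mkseq s n) B)%:E = rho (block 0 @^-1` B))%E.
Proof.
move=> stat k0 kn mB.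
have mblock i : measurable (@block A k i @^-1` B) := measurable_cylinder i mB.
pose N := (n - k + 1)%N.
transitivity (\int[rho]_s (N%:R^-1%:E *
    (\sum_(0 <= i < N) (\1_(block i @^-1` B) s)%:E)%E))%E.
  by apply: eq_integral => s _; rewrite freq_mkseq// EFinM -sumEFin.
have N0 : N%:R != 0 :> R by rewrite /N addn1 pnatr_eq0.
have mind i : measurable_fun setT
    (fun s : infinite_word A => (\1_(block i @^-1` B) s)%:E : \bar R).
  by apply/measurable_EFinP; exact: measurable_indic.
have intE i : (\int[rho]_s (\1_(block i @^-1` B) s)%:E =
    rho (block 0 @^-1` B))%E.
  by rewrite integral_indic// setIT; apply/esym/stat.
rewrite ge0_integralZl//; last 2 first.
- by apply: emeasurable_sum => i; exact: mind.
- by move=> s _; apply: sume_ge0 => i _; rewrite lee_fin.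
rewrite ge0_integral_sum//.
under eq_bigr do rewrite intE.
rewrite -(fineK (fin_num_measure rho _ (mblock 0%N))).
by rewrite sumEFin -EFinM sumr_const_nat subn0 -[X in _ * X]mulr_natl mulKf.
Qed.

(** Ergodicity gives convergence to some constant [c]; stationarity makes the
    expectation of every frequency equal to the probability of the cylinder, and
    by dominated convergence that probability must be [c]. *)
Lemma freq_cvg k (B : set (word A k)) :
  stationary_ergodic rho -> (0 < k)%N -> measurable B ->
  {ae rho, forall s, freq R (mkseq s n) B @[n --> \oo] -->
    fine (rho (block 0 @^-1` B))}.
Proof.
move=> [stat erg] k0 mB; have [c freqc] := erg k B k0 mB.
have mblock : measurable (@block A k 0 @^-1` B) := measurable_cylinder 0 mB.
suff -> : fine (rho (block 0 @^-1` B)) = c by [].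
pose f n (s : infinite_word A) := (freq R (mkseq s n) B)%:E.
have mf n : measurable_fun setT (f n).
  by apply/measurable_EFinP; exact: measurable_freq.
have fc : {ae rho, forall s, setT s -> f ^~ s @ \oo --> c%:E}.
  have aeF : Filter (almost_everywhere rho) := ae_filter_ringOfSetsType rho.
  by apply: filterS freqc => s fs _; apply: cvg_EFin => //; exact: nearW.
have f1 : {ae rho, forall s n, setT s -> (`|f n s| <= cst 1 s)%E}.
  by apply: aeW => s n _; rewrite lee_fin ger0_norm ?freq_ge0 ?freq_le1.
have int1 : rho.-integrable setT (cst 1%E).
  exact: finite_measure_integrable_cst.
have [_ _] := dominated_convergence measurableT mf (measurable_cst c%:E)
  fc int1 f1.
rewrite integral_cst// [X in (_ * X)%E](@probability_setT _ _ _ rho) mule1.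
move=> intf.
have : (\int[rho]_s f n s)%E @[n --> \oo] --> rho (block 0 @^-1` B).
  apply: cvg_near_cst; near=> n; apply: expected_freq => //.
  by near: n; exists k.
by move=> /(cvg_unique _ intf) <-.
Unshelve. all: by end_near. Qed.

End ergodic_frequencies.

(** * Distances built on resolving partitions *)

Section resolving_partitions.
Context (A : ptopologicalType) (R : realType).
Variable Q : forall m : nat, nat -> set (set (word A m)).
Arguments Q : clear implicits.

(** The common form of both empirical distances. Here [Q m l] is the partition
    of the words of length [m] at resolution [l]. *)
Definition cell_distance (x y : seq A) : \bar R :=
  (\sum_(1 <= m <oo) \sum_(1 <= l <oo) (weight R m * weight R l)%:E *
    \esum_(B in Q m l) `|freq R x B - freq R y B|%:E)%E.

(** What the test needs from the partitions. Along the diagonal [m = l] the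
    cylinders over the cells form ever finer nested partitions of the infinite
    words that generate the topology. The diagonal matters for nestedness: a
    cell of smaller dimension but finer resolution may overlap another without
    being comparable to it. *)
Record resolving : Prop := Resolving {
  resolving_partition : forall m l, countable_partition (Q m l);
  resolving_nested : forall n B B', Q n.+1 n.+1 B -> Q n.+2 n.+2 B' ->
    block 0 @^-1` B `&` block 0 @^-1` B' !=set0 ->
    block 0 @^-1` B' `<=` (block 0 @^-1` B : set (infinite_word A));
  resolving_fine : forall (s : infinite_word A) j (V : set A), nbhs (s j) V ->
    \forall n \near \oo, forall B (t : infinite_word A), Q n.+1 n.+1 B ->
      B (block 0 s) -> B (block 0 t) -> V (t j) }.

Hypothesis resQ : resolving.

(** The diagonal cylinders separate laws. If an open [U] contained no cylinder
    around [s], there would be for each [n] a word outside of [U] in the same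
    [n]-th cell as [s]; these words converge to [s] coordinatewise, hence in the
    product topology, and so eventually enter [U]. *)
Lemma same_law_cells (mu nu : process A R) :
  (forall n B, Q n.+1 n.+1 B -> mu (block 0 @^-1` B) = nu (block 0 @^-1` B)) ->
  same_law mu nu.
Proof.
move=> munu; pose C n := [set @block A n.+1 0 @^-1` B | B in Q n.+1 n.+1].
apply: (@nested_partitions_determine _ (@open {ptws nat -> A}) R C).
- by move=> U V; exact: openI.
- exact: openT.
- move=> n; have [cQ mQ tQ covQ] := resolving_partition resQ n.+1 n.+1.
  split.
  + exact: sub_countable (card_image_le _ _) cQ.
  + by move=> _ [B QB <-]; apply: measurable_cylinder; exact: mQ.
  + move=> _ _ [B QB <-] [B' QB' <-] [s [Bs B's]].
    by rewrite (tQ _ _ QB QB')//; exists (block 0 s).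
  + rewrite -subTset => s _; have : setT (@block A n.+1 0 s) by [].
    by rewrite -covQ => -[B QB Bs]; exists (block 0 @^-1` B) => //; exists B.
- by move=> n _ _ [B QB <-] [B' QB' <-]; exact: resolving_nested.
- move=> U s oU Us; apply: contrapT => noC.
  have {noC} bad n : exists t, ~ U t /\
      exists B, [/\ Q n.+1 n.+1 B, B (block 0 s) & B (block 0 t)].
    have [_ _ _ covQ] := resolving_partition resQ n.+1 n.+1.
    have : setT (@block A n.+1 0 s) by [].
    rewrite -covQ => -[B QB Bs]; apply: contrapT => good; apply: noC.
    exists n, (block 0 @^-1` B); split => //; first by exists B.
    move=> t Bt; apply: contrapT => Ut; apply: good.
    by exists t; split => //; exists B.
  have [t tP] := choice bad.
  have : (t : nat -> {ptws nat -> A}) @ \oo --> (s : {ptws nat -> A}).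
    apply: cvg_ptws => j V /(resolving_fine resQ); apply: filterS => n.
    by have [_ [B [QB Bs Bt]]] := tP n; apply; eauto.
  move=> /(_ U (open_nbhs_nbhs (conj oU Us))) [n _ /(_ n (leqnn n))].
  by have [] := tP n.
- by move=> n _ [B QB <-]; exact: munu.
Qed.

Lemma cell_distance_ge m l (B : set (word A m)) (x y : seq A) :
  (0 < m)%N -> (0 < l)%N -> Q m l B ->
  ((weight R m * weight R l * `|freq R x B - freq R y B|)%:E <=
    cell_distance x y)%E.
Proof.
have term (f : nat -> \bar R) k : (forall i, 0 <= f i)%E -> (0 < k)%N ->
    (f k <= \sum_(1 <= i <oo) f i)%E.
  move=> f0 k0; apply: le_trans (nneseries_lim_ge k.+1 _); last by [].
  by rewrite big_nat_recr//= leeDr// sume_ge0.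
have w0 i j : 0 <= weight R i * weight R j by rewrite mulr_ge0 ?weight_ge0.
have e0 i j : (0 <= (weight R i * weight R j)%:E *
    \esum_(B in Q i j) `|freq R x B - freq R y B|%:E)%E.
  by rewrite mule_ge0 ?lee_fin// esum_ge0.
move=> m0 l0 QB; apply: le_trans (term _ _ _ m0); last first.
  by move=> i; apply: nneseries_ge0.
apply: le_trans (term _ _ _ l0); last by [].
rewrite EFinM lee_wpmul2l ?lee_fin//; apply: esum_ge; exists [set B].
  by split => // _ ->.
by rewrite fsbig_set1.
Qed.

(** The almost sure event on which the argument runs: the statements about
    distances that follow are deterministic on such paths. *)
Definition typical (rho : process A R) (s : infinite_word A) :=
  forall m l B, (0 < m)%N -> Q m l B ->
    freq R (mkseq s n) B @[n --> \oo] --> fine (rho (block 0 @^-1` B)).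

Lemma typical_ae (rho : process A R) (d : measure_display)
    (Omega : measurableType d) (P : probability Omega R)
    (X : {mfun Omega >-> infinite_word A}) :
  stationary_ergodic rho -> same_law (distribution P X) rho ->
  {ae P, forall w, typical rho (X w)}.
Proof.
move=> se lawX.
have transfer (E : infinite_word A -> Prop) :
    {ae rho, forall s, E s} -> {ae P, forall w, E (X w)}.
  move=> [N [mN N0 EN]]; exists (X @^-1` N); split.
  - by rewrite -[X in measurable X]setTI; exact: measurable_funP.
  - by rewrite -N0; exact: lawX.
  - by move=> w Ew; exact: EN.
apply: transfer; apply: ae_foralln => m; apply: ae_foralln => l.
have [->|m0] := posnP m; first by apply: aeW => s B.
have [cQ mQ _ _] := resolving_partition resQ m l.
have aeF : Filter (almost_everywhere rho) := ae_filter_ringOfSetsType rho.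
apply: filterS (ae_countable cQ (fun B QB => freq_cvg se m0 (mQ B QB))).
by move=> s sQ B _ /sQ.
Qed.

(** On each partition the distance tends to 0 by [scheffe], and the weights
    carry this to the double series through two uses of
    [weighted_series_small]. *)
Lemma cell_distance_small (rho : process A R) (s t : infinite_word A) (e : R) :
  typical rho s -> typical rho t -> 0 < e ->
  \forall n \near (\oo, \oo),
    (cell_distance (mkseq s n.1) (mkseq t n.2) <= e%:E)%E.
Proof.
move=> rs rt e0.
pose E (n : nat * nat) m l := (\esum_(B in Q m l)
  `|freq R (mkseq s n.1) B - freq R (mkseq t n.2) B|%:E)%E.
have E0 n m l : (0 <= E n m l)%E by exact: esum_ge0.
have E2 n m l : (E n m l <= 2%:E)%E.
  by have [_ _ tQ _] := resolving_partition resQ m l; exact: sum_freq_dist_le2.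
have Esmall m l : (0 < m)%N -> forall r : R, 0 < r ->
    \forall n \near (\oo, \oo), (E n m l <= r%:E)%E.
  move=> m0; have [cQ mQ tQ covQ] := resolving_partition resQ m l.
  move=> r r0; apply: (@scheffe R _ (Q m l) _ (filter_prod \oo \oo) _
    (fun n B => freq R (mkseq s n.1) B) (fun n B => freq R (mkseq t n.2) B)
    (fun B => fine (rho (block 0 @^-1` B)))) r0.
  - by move=> n B _; exact: freq_ge0.
  - by move=> n B _; exact: freq_ge0.
  - by move=> n; exact: sum_freq_le1.
  - by move=> n; exact: sum_freq_le1.
  - rewrite (eq_esum (b := fun B => rho (block 0 @^-1` B))); last first.
      move=> B /mQ mB; rewrite fineK// fin_num_measure//.
      exact: measurable_cylinder.
    rewrite -measure_bigcup_countable//.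
    + rewrite -preimage_bigcup covQ preimage_setT.
      by rewrite [leRHS](_ : _ = 1%E)//; exact: probability_setT.
    + by move=> B /mQ; exact: measurable_cylinder.
    + by move=> B C QB QC [u [Bu Cu]]; apply: tQ => //; exists (block 0 u).
  - by move=> B QB; exact: cvg_comp cvg_fst (rs _ _ _ m0 QB).
  - by move=> B QB; exact: cvg_comp cvg_snd (rt _ _ _ m0 QB).
have distE n : cell_distance (mkseq s n.1) (mkseq t n.2) =
    (\sum_(1 <= m <oo) (weight R m)%:E *
      \sum_(1 <= l <oo) (weight R l)%:E * E n m l)%E.
  apply: eq_eseriesr => m _; rewrite -nneseriesZl.
    by apply: eq_eseriesr => l _; rewrite EFinM muleA.
  by move=> l _; rewrite mule_ge0 ?lee_fin ?weight_ge0.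
suff : \forall n \near (\oo, \oo), (\sum_(1 <= m <oo) (weight R m)%:E *
    \sum_(1 <= l <oo) (weight R l)%:E * E n m l <= e%:E)%E.
  by apply: filterS => n; rewrite distE.
apply: (@weighted_series_small R _ (filter_prod \oo \oo) _
  (fun n m => \sum_(1 <= l <oo) (weight R l)%:E * E n m l)%E 2) => //.
- move=> n m; apply: nneseries_ge0 => l _ _.
  by rewrite mule_ge0 ?lee_fin ?weight_ge0.
- by move=> n m; exact: weighted_series_le.
- move=> m r m0 r0; apply: (@weighted_series_small R _ (filter_prod \oo \oo) _
    (fun n l => E n m l) 2) => //.
  by move=> l r' _ r'0; exact: Esmall.
Qed.

(** A single cell on which the laws differ already contributes, in the limit, a
    positive amount to the distance; half of it is a safe lower bound. *)
Lemma cell_distance_bounded_below (mu nu : process A R)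
    (s t : infinite_word A) :
  typical mu s -> typical nu t -> ~ same_law mu nu ->
  exists2 e : R, 0 < e & \forall n \near (\oo, \oo),
    (e%:E < cell_distance (mkseq s n.1) (mkseq t n.2))%E.
Proof.
move=> mus nut munu.
have [n [B [QB Bne]]] : exists n B, Q n.+1 n.+1 B /\
    mu (block 0 @^-1` B) != nu (block 0 @^-1` B).
  apply: contrapT => noB; apply: munu; apply: same_law_cells => n B QB.
  by apply/eqP/negPn/negP => Bne; apply: noB; exists n, B.
have [_ mQ _ _] := resolving_partition resQ n.+1 n.+1.
pose p := fine (mu (block 0 @^-1` B)); pose q := fine (nu (block 0 @^-1` B)).
have mB : measurable (@block A n.+1 0 @^-1` B).
  exact: measurable_cylinder (mQ _ QB).
have pE : mu (block 0 @^-1` B) = p%:E by rewrite fineK// fin_num_measure.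
have qE : nu (block 0 @^-1` B) = q%:E by rewrite fineK// fin_num_measure.
have pq : 0 < `|p - q|.
  by rewrite normr_gt0 subr_eq0; move: Bne; rewrite pE qE.
pose w := weight R n.+1 * weight R n.+1.
have w0 : 0 < w by rewrite mulr_gt0// invr_gt0.
have lim : `|freq R (mkseq s k.1) B - freq R (mkseq t k.2) B|
    @[k --> (\oo, \oo)] --> `|p - q|.
  apply: cvg_norm; apply: cvgB.
    exact: cvg_comp cvg_fst (mus _ _ _ _ QB).
  exact: cvg_comp cvg_snd (nut _ _ _ _ QB).
exists (w * (`|p - q| / 2)); first by rewrite mulr_gt0// divr_gt0.
have half : `|p - q| / 2 < `|p - q| by lra.
apply: filterS (cvgr_gt _ lim _ half) => k klo.
apply: lt_le_trans (cell_distance_ge _ _ _ _ QB) => //.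
by rewrite lte_fin ltr_pM2l.
Qed.

(** Between the samples with the same law the distance tends to 0, and between
    those with different laws it stays above a positive bound. *)
Lemma same_law_eventually_closer (rho rho' : process A R) (d : measure_display)
    (Omega : measurableType d) (P : probability Omega R)
    (X Y Z : {mfun Omega >-> infinite_word A}) :
  stationary_ergodic rho -> stationary_ergodic rho' -> ~ same_law rho' rho ->
  same_law (distribution P X) rho -> same_law (distribution P Y) rho' ->
  same_law (distribution P Z) rho ->
  {ae P, forall w, exists N : nat, forall n1 n2 n3 : nat,
      (N <= n1)%N -> (N <= n2)%N -> (N <= n3)%N ->
      (cell_distance (mkseq (X w) n1) (mkseq (Z w) n3) <
       cell_distance (mkseq (Y w) n2) (mkseq (Z w) n3))%E}.
Proof.
move=> se se' neq lawX lawY lawZ.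
apply: filterS3 (typical_ae se lawX) (typical_ae se' lawY) (typical_ae se lawZ).
move=> w tX tY tZ; have [e e0 far] := cell_distance_bounded_below tY tZ neq.
have [[I1 I3] /= [[N1 _ I1N1] [N3 _ I3N3]] near_XZ] :=
  cell_distance_small tX tZ e0.
have [[J2 J3] /= [[M2 _ J2M2] [M3 _ J3M3]] far_YZ] := far.
exists (maxn (maxn N1 N3) (maxn M2 M3)) => n1 n2 n3.
rewrite !geq_max => /andP[/andP[h1 _] _] /andP[_ /andP[h2 _]].
move=> /andP[/andP[_ h3] /andP[_ h4]].
apply: le_lt_trans (far_YZ (n2, n3) _); first apply: (near_XZ (n1, n3)).
  by split; [exact: I1N1|exact: I3N3].
by split; [exact: J2M2|exact: J3M3].
Qed.

End resolving_partitions.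

(** * Finite alphabets and dyadic cubes *)

Lemma countable_fun_ord (T : Type) (m : nat) :
  countable [set: T] -> countable [set: 'I_m -> T].
Proof.
move=> /countable_injP[f finj]; apply/countable_injP.
exists (fun t => choice.pickle [ffun j : 'I_m => f (t j)]) => t u _ _.
move=> /(pcan_inj choice.pickleK)/ffunP tu; apply/funext => j.
by apply: finj; rewrite ?in_setT//; have := tu j; rewrite !ffunE.
Qed.

Section finite_alphabets.
Context (R : realType) (A : pdiscreteTopologicalType).
Hypothesis finA : finite_set [set: A].

(** The resolution is ignored: words over a discrete alphabet are already
    separated at every resolution. *)
Definition singletons (m : nat) (_ : nat) : set (set (word A m)) := range set1.
Arguments singletons : clear implicits.

Lemma resolving_singletons : resolving singletons.
Proof.
split.
- move=> m l; split.
  + apply: sub_countable (card_image_le _ _) _.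
    exact/countable_fun_ord/finite_set_countable.
  + move=> _ [b _ <-].
    rewrite (_ : [set b] =
        [set t | forall j, [set t : word A m | [set b j] (t j)] t]).
      apply: measurable_forall_coordinate => j; apply: measurable_coordinate.
      exact: discrete_open.
    by apply/seteqP; split => [t ->//|t tb]; apply/funext => j; exact: tb.
  + by move=> _ _ [b _ <-] [c _ <-] [t [-> ->]].
  + by rewrite -subTset => t _; exists [set t] => //; exists t.
- move=> n _ _ [b _ <-] [c _ <-] [s [sb sc]] t tc; apply/funext => j.
  have := congr1 (@^~ (widen_ord (leqnSn _) j)) (etrans tc (esym sc)).
  by rewrite /block/= => ->; rewrite -sb.
- move=> s j V sV; exists j => // n/= jn _ t [b _ <-] sb tb.
  have := congr1 (@^~ (Ordinal (jn : (j < n.+1)%N))) (etrans tb (esym sb)).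
  by rewrite /block/= add0n => ->; exact: nbhs_singleton.
Qed.

(** The distance for finite alphabets has no sum over the resolution, but as the
    singletons do not depend on it that sum only contributes the factor 1. *)
Lemma dhat_finiteE (x y : seq A) :
  dhat_finite R x y = cell_distance R singletons x y.
Proof.
apply: eq_eseriesr => m _.
have inj1 : set_inj setT (set1 : word A m -> set (word A m)).
  by move=> b c _ _ bc; have : [set b] b by []; rewrite bc.
rewrite -(esum_image _ _ (fun B => `|freq R x B - freq R y B|%:E) inj1).
have tS : trivIset (singletons m 0%N) id.
  by move=> _ _ [b _ <-] [c _ <-] [t [-> ->]].
rewrite -/(singletons m 0%N).
have fin : (\esum_(B in singletons m 0%N)
    `|freq R x B - freq R y B|%:E)%E \is a fin_num.
  rewrite fin_real// (lt_le_trans _ (esum_ge0 _))//=.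
  by rewrite (le_lt_trans (sum_freq_dist_le2 R x y tS))// ltry.
rewrite -[in LHS](fineK fin) -(weighted_series_cst (fine _)).
rewrite -nneseriesZl; last first.
  by move=> l _; rewrite mule_ge0 ?lee_fin ?weight_ge0 ?fine_ge0 ?esum_ge0.
by apply: eq_eseriesr => l _; rewrite fineK// EFinM muleA.
Qed.

End finite_alphabets.

Section real_alphabet.
Context (R : realType).

(** Cells of the dyadic grid are the fibres of the rounding map, from which
    disjointness, covering and nestedness follow at once. *)
Lemma cubeP m l (c : 'I_m -> int) (t : word R m) :
  cube l c t <-> forall j, Num.floor (t j * 2 ^+ l) = c j.
Proof.
have p0 : 0 < 2 ^+ l :> R by rewrite exprn_gt0.
split=> [ct j|tc j].
  apply: floor_def; have /andP[lo hi] := ct j.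
  by rewrite -ler_pdivrMr// lo/= -ltr_pdivlMr.
by rewrite ler_pdivrMr// ltr_pdivlMr// -tc floor_itv.
Qed.

Lemma floor_eq_of_double (x y : R) :
  Num.floor (x * 2) = Num.floor (y * 2) -> Num.floor x = Num.floor y.
Proof.
move=> xy; apply/esym/floor_def.
have /andP[lo hi] := floor_itv x; apply/andP; split.
  have : Num.floor x * 2 <= Num.floor (y * 2).
    by rewrite -xy floor_ge_int intrM ler_pM2r.
  by rewrite floor_ge_int intrM ler_pM2r.
have : Num.floor (y * 2) < (Num.floor x + 1) * 2.
  by rewrite -xy floor_lt_int intrM ltr_pM2r.
by rewrite floor_lt_int intrM ltr_pM2r.
Qed.

Lemma resolving_cubes : resolving (@cubes R).
Proof.
split.
- move=> m l; split.
  + apply: sub_countable (card_image_le _ _) _.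
    exact/countable_fun_ord.
  + move=> _ [c _ <-]; apply: measurable_forall_coordinate => j.
    rewrite [X in measurable X](_ : _ =
        ~` [set t : word R m | t j < (c j)%:~R * 2 ^- l] `&`
        [set t : word R m | t j < (c j + 1)%:~R * 2 ^- l]).
      have mlt (y : R) : measurable [set t : word R m | t j < y].
        apply: (@measurable_coordinate R m j [set x | x < y]).
        exact: open_lt.
      by apply: measurableI => //; exact: measurableC.
    by apply/seteqP; split => [t /= /andP[lo hi]|t [/= /negP lo hi]];
      rewrite ?hi ?andbT ?leNgt//; split => //; apply/negP; rewrite -leNgt.
  + move=> _ _ [b _ <-] [c _ <-] [t [/cubeP tb /cubeP tc]].
    by congr cube; apply/funext => j; rewrite -tb -tc.
  + rewrite -subTset => t _.
    exists (cube l (fun j => Num.floor (t j * 2 ^+ l))).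
      by exists (fun j => Num.floor (t j * 2 ^+ l)).
    exact/cubeP.
- move=> n _ _ [b _ <-] [c _ <-] [s [/cubeP sb /cubeP sc]] t /cubeP tc.
  apply/cubeP => j; rewrite -sb; apply: floor_eq_of_double.
  rewrite -!mulrA -!exprSr.
  by rewrite (tc (widen_ord (leqnSn _) j)) (sc (widen_ord (leqnSn _) j)).
- move=> s j V /nbhs_ballP[e /= e0 eV].
  near=> n => _ t [b _ <-] /cubeP sb /cubeP tb; apply: eV.
  have jn : (j < n.+1)%N by rewrite ltnS; near: n; exists j.
  have := etrans (tb (Ordinal jn)) (esym (sb (Ordinal jn))).
  rewrite /block/= add0n => fl.
  have p0 : 0 < 2 ^+ n.+1 :> R by rewrite exprn_gt0.
  have : `|s j * 2 ^+ n.+1 - t j * 2 ^+ n.+1| < 1.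
    have /andP[] := floor_itv (s j * 2 ^+ n.+1).
    have /andP[] := floor_itv (t j * 2 ^+ n.+1).
    by rewrite fl intrD ltr_norml; move=> *; apply/andP; split; lra.
  rewrite -mulrBl normrM (gtr0_norm p0) -ltr_pdivlMr// => /lt_le_trans; apply.
  near: n; apply: filterS (near_infty_natSinv_lt (PosNum e0)) => n /= /ltW.
  apply: le_trans; rewrite div1r lef_pV2 ?posrE// -natrX ler_nat.
  by rewrite ltnW// ltn_expl.
Unshelve. all: by end_near. Qed.

End real_alphabet.

(** * Consistency of the test *)

Lemma dhat_cell_distance (R : realType) (a : alphabet R) :
  exists2 Q : forall m : nat, nat -> set (set (word (letter a) m)),
    resolving Q & forall x y, @dhat R a x y = cell_distance R Q x y.
Proof.
case: a => [|A finA].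
  by exists (@cubes R); [exact: resolving_cubes|].
by exists (@singletons A); [exact: resolving_singletons|exact: dhat_finiteE].
Qed.

Lemma same_law_sym (A : ptopologicalType) (R : realType)
    (mu nu : set (infinite_word A) -> \bar R) :
  same_law mu nu -> same_law nu mu.
Proof. by move=> munu B mB; rewrite munu. Qed.

Lemma same_law_trans (A : ptopologicalType) (R : realType)
    (lambda mu nu : set (infinite_word A) -> \bar R) :
  same_law lambda mu -> same_law mu nu -> same_law lambda nu.
Proof. by move=> lm mn B mB; rewrite lm// mn. Qed.

Theorem theorem3p1 (R : realType) (a : alphabet R)
  (rho_x rho_y rho_z : process (letter a) R)
  (se_x : stationary_ergodic rho_x)
  (se_y : stationary_ergodic rho_y)
  (se_z : stationary_ergodic rho_z)
  (neq_xy : ~ same_law rho_x rho_y)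
  (z_or : same_law rho_z rho_x \/ same_law rho_z rho_y)
  (d : measure_display) (Omega : measurableType d) (P : probability Omega R)
  (X Y Z : {mfun Omega >-> infinite_word (letter a)})
  (law_X : same_law (distribution P X) rho_x)
  (law_Y : same_law (distribution P Y) rho_y)
  (law_Z : same_law (distribution P Z) rho_z) :
  (same_law rho_x rho_z ->
    {ae P, forall w, exists N : nat, forall n1 n2 n3 : nat,
      (N <= n1)%N -> (N <= n2)%N -> (N <= n3)%N ->
      L (mkseq (X w) n1) (mkseq (Y w) n2) (mkseq (Z w) n3) = label_x}) /\
  (~ same_law rho_x rho_z ->
    {ae P, forall w, exists N : nat, forall n1 n2 n3 : nat,
      (N <= n1)%N -> (N <= n2)%N -> (N <= n3)%N ->
      L (mkseq (X w) n1) (mkseq (Y w) n2) (mkseq (Z w) n3) = label_y}).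
Proof.
have [Q resQ dhatE] := dhat_cell_distance a.
split=> [xz|not_xz].
  have neq_yx : ~ same_law rho_y rho_x.
    by move=> /same_law_sym.
  have law_Zx := same_law_trans law_Z (same_law_sym xz).
  have := same_law_eventually_closer resQ se_x se_y neq_yx law_X law_Y law_Zx.
  apply: filterS => w [N closer]; exists N => n1 n2 n3 h1 h2 h3.
  by rewrite /L !dhatE ltW// closer.
have zy : same_law rho_z rho_y by case: z_or => // /same_law_sym.
have law_Zy := same_law_trans law_Z zy.
have := same_law_eventually_closer resQ se_y se_x neq_xy law_Y law_X law_Zy.
apply: filterS => w [N closer]; exists N => n1 n2 n3 h1 h2 h3.
by rewrite /L !dhatE leNgt closer.
Qed.
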